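(* There exist a countable metrizable topological group $G$ and a continuous action of $G$ on the space $\mathbb{Q}$ of rational numbers (with its usual topology) such that the only equivariant compactification of the $G$-space $\mathbb{Q}$ is a singleton; that is, for every equivariant compactification $(K,i)$ of the $G$-space $\mathbb{Q}$, the space $K$ consists of a single point.
   Context: Topological groups are Hausdorff. An action of a topological group $G$ on a topological space $X$ is continuous if the map $G\times X\to X$, $(g,x)\mapsto gx$, is (jointly) continuous. If $G$ acts continuously on a Tychonoff space $X$, an equivariant compactification of $X$ is a compact Hausdorff space $K$ equipped with a continuous action of $G$, together with a continuous $G$-equivariant map $i\colon X\to K$ whose image is dense in $K$ (the map $i$ is not required to be injective or a topological embedding). *)

(* Defs.v *)
From HB Require Import structures.
From mathcomp Require Import all_boot all_order all_algebra.
From mathcomp Require Import all_classical all_reals all_analysis.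

Set Implicit Arguments.
Unset Strict Implicit.
Unset Printing Implicit Defensive.

Import Order.TTheory GRing.Theory Num.Theory.

Local Open Scope classical_set_scope.

(* Groups are multiplicative and not assumed commutative; topological groups
   are Hausdorff by convention. *)
HB.mixin Record isTopologicalGroup G of Topological G & Group G := {
  mulg_continuous : continuous (fun p : G * G => (p.1 * p.2)%g) ;
  invg_continuous : continuous (fun x : G => (x^-1)%g) ;
  topgroup_hausdorff : hausdorff_space G
}.

#[short(type="topologicalGroupType")]
HB.structure Definition TopologicalGroup :=
  {G of isTopologicalGroup G & Topological G & Group G}.

Section Metrizable.
Local Open Scope ring_scope.

(* Nonnegativity of d follows from the first three clauses. *)
Definition metrizable (R : realType) (T : topologicalType) : Prop :=
  exists d : T -> T -> R,
    [/\ forall x y, d x y = 0 <-> x = y,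
        forall x y, d x y = d y x,
        forall x y z, d x z <= d x y + d y z
      & forall x, nbhs x = nbhs_ball_ (fun y e => [set z | d y z < e]) x].

End Metrizable.

(* The last clause is joint continuity, for the product topology on G * X. *)
Record continuous_action (G : topologicalGroupType) (X : topologicalType)
    (act : G -> X -> X) : Prop := ContinuousAction {
  cact1 : forall x, act 1%g x = x ;
  cactM : forall g h x, act (g * h)%g x = act g (act h x) ;
  cact_continuous : continuous (fun p : G * X => act p.1 p.2)
}.

(* The map i need be neither injective nor a topological embedding. *)
Record equivariant_compactification (G : topologicalGroupType)
    (X : topologicalType) (actX : G -> X -> X)
    (K : topologicalType) (actK : G -> K -> K) (i : X -> K) : Prop :=
  EquivariantCompactification {
    eqcpt_compact : compact [set: K] ;
    eqcpt_hausdorff : hausdorff_space K ;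
    eqcpt_action : continuous_action actK ;
    eqcpt_continuous : continuous i ;
    eqcpt_equivariant : forall g x, i (actX g x) = actK g (i x) ;
    eqcpt_dense : dense (range i)
  }.

(* Main.v *)
From HB Require Import structures.
Require Import Defs.
From mathcomp Require Import all_boot all_order all_algebra.
From mathcomp Require Import all_classical all_reals all_analysis.
From mathcomp Require Import zify lra.

(** The space consists of the words over [nat * int], built from nested fans.
    A word [w] is the left endpoint of an edge, whose interior is the set of
    proper extensions of [w]. The interior of the edge is filled with countably
    many arcs, indexed by [l]; the vertices [w ++ [:: (l, j)]], [j] in [int], run
    along the [l]-th arc, converging uniformly in [l] to the left endpoint of
    the edge as [j] tends to minus infinity and to the right endpoint as [j]
    tends to plus infinity. The interval between two consecutive vertices of an
    arc is again such an edge. This space is countable and crowded with a clopen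
    base, hence homeomorphic to the rationals.

    The group is generated by the shifts of the individual arcs. It permutes a
    countable base of open sets, and is topologized by pointwise convergence on
    that base, so that the action is automatically continuous. Each basic open
    set contains or misses the interior of all but finitely many of the edges
    from [u ++ [:: (l, j)]] to [u ++ [:: (l, j + 1)]], for fixed [u] and [j]; hence
    any group elements supported in these edges tend to [1] as [l] grows. Such
    elements can push an interior point of the edge towards either endpoint, so
    in a compactification [i] the limits of [i (u ++ [:: (l, j)])] along an
    ultrafilter in [l] do not depend on [j]. Letting [j] tend to both infinities
    identifies the images of the two endpoints of the edge [u]. *)

Set Implicit Arguments.
Unset Strict Implicit.
Unset Printing Implicit Defensive.

Import Order.TTheory GRing.Theory Num.Theory.
Local Open Scope classical_set_scope.

(** * Words and stars *)

Definition letter := (nat * int)%type.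
Definition word := seq letter.
HB.instance Definition _ := Countable.on word.

(* The edge [rcons u (prev c)] ends at the vertex [rcons u c]. *)
Definition prev (c : letter) : letter := (c.1, (c.2 - 1)%R).

Definition left_germ (J : nat) : pred word :=
  fun x => if x is c :: _ then (c.2 < - J%:Z)%R else true.

(** The points strictly to the right of the vertices of index [J], on all arcs at once. At index [J]
    itself only the interior of the next edge counts, hence the test [y != [::]]. *)
Definition right_germ (J : nat) : pred word :=
  fun x => if x is c :: y then (J%:Z < c.2)%R || (c.2 == J) && (y != [::])
           else false.

(* [w] followed by a word in [P], or, when [w = rcons u c], [rcons u (prev c)]
   followed by a word in [Q]: the union of a left end of the edge starting at [w]
   and a right end of the edge arriving at [w]. *)
Fixpoint around (P Q : pred word) (w x : word) : bool :=
  if w is c :: w' then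
    if x is d :: x' then
      if w' is [::] then (d == c) && P x' || (d == prev c) && Q x'
      else (d == c) && around P Q w' x'
    else false
  else P x.

Definition star (J : nat) : word -> pred word :=
  around (left_germ J) (right_germ J).

(* Vertices of an edge to the left of the irrational position [n, 0, 0, ...]
   (for the lexicographic order that forgets the arcs), which is no vertex. *)
Fixpoint cut (n : int) (x : word) : bool :=
  if x is c :: y then (c.2 < n)%R || (c.2 == n) && cut 0%R y else true.

(** Stars are open but not closed: the vertices of index [- J] inside the edge [w] lie in the
    closure of [star J w]. Cutting at irrational positions avoids such boundary points. *)
Definition clopen_star (J : nat) : word -> pred word :=
  around (cut (- J%:Z)%R) (predC (cut J)).

Lemma prevK c d : (prev c == prev d) = (c == d).
Proof. by case: c d => [l j] [l' j']; rewrite /prev !xpair_eqE /=; lia. Qed.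

Lemma prev_neq c : (prev c == c) = false.
Proof. by case: c => [l j]; rewrite /prev xpair_eqE /=; lia. Qed.

Lemma neq_prev c : (c == prev c) = false.
Proof. by rewrite eq_sym prev_neq. Qed.

Lemma around_sub (P Q P' Q' : pred word) w x :
  (forall x, P x -> P' x) -> (forall x, Q x -> Q' x) ->
  around P Q w x -> around P' Q' w x.
Proof.
move=> PP QQ; elim: w x => [|c w IH] [|d x] //=; try exact: PP.
case: w IH => [_|e w IH].
  by move=> /orP[]/andP[-> H]; rewrite ?(PP _ H) ?(QQ _ H) ?orbT.
by move=> /andP[-> /IH].
Qed.

Lemma around_self (P Q : pred word) w : P [::] -> around P Q w w.
Proof.
move=> P0; elim: w => [|c w IH] //=; case: w IH => [_|e w IH].
  by rewrite eqxx P0.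
by rewrite eqxx.
Qed.

Lemma around_cat (P Q : pred word) w x : P x -> around P Q w (w ++ x).
Proof.
move=> Px; elim: w => [|c w IH] //=; case: w IH => [_|e w IH].
  by rewrite eqxx Px.
by rewrite eqxx.
Qed.

Lemma around_prev (P Q : pred word) u c x : Q x ->
  around P Q (rcons u c) (rcons u (prev c) ++ x).
Proof.
move=> Qx; elim: u => [|d u IH] /=; first by rewrite eqxx Qx orbT.
by rewrite eqxx; case: u IH.
Qed.

Lemma around_cons2 (P Q : pred word) c d w x :
  around P Q (c :: d :: w) x -> exists2 y, x = c :: y & around P Q (d :: w) y.
Proof. by case: x => [|e x] //= /andP[/eqP-> H]; exists x. Qed.

Lemma left_germ_le J J' x : (J <= J')%N -> left_germ J' x -> left_germ J x.
Proof. by case: x => [|[l j] x] //=; lia. Qed.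

Lemma right_germ_le J J' x : (J <= J')%N -> right_germ J' x -> right_germ J x.
Proof.
case: x => [|[l j] x] //= JJ' /orP[H|/andP[/eqP-> ->]]; first by lia.
by rewrite andbT; lia.
Qed.

Lemma star_le J J' w x : (J <= J')%N -> star J' w x -> star J w x.
Proof.
by move=> JJ'; apply: around_sub => y; [apply: left_germ_le|apply: right_germ_le].
Qed.

Lemma star_self J w : star J w w. Proof. exact: around_self. Qed.

(** * Open sets of words, in terms of stars *)

Definition word_open (A : set word) :=
  forall v, A v -> exists J, forall x, star J v x -> A x.

Lemma word_open_left_germ J : word_open (fun x => left_germ J x).
Proof.
case=> [|c [|d v]] /=; first by exists J.
- move=> Hc; exists 0%N => -[|e x] //=.
  by case/orP => /andP[/eqP->] //= _; rewrite /prev /=; lia.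
- by move=> Hc; exists 0%N => x /around_cons2[y -> _].
Qed.

Lemma word_open_right_germ J : word_open (fun x => right_germ J x).
Proof.
case=> [|c [|d v]] //=.
- rewrite andbF orbF => Hc; exists 0%N => -[|e x] //=.
  case/orP => /andP[/eqP->] //=; first by rewrite Hc.
  by case: x => [|f x] //= _; lia.
- move=> Hc; exists 0%N => x /around_cons2[y ->] /=.
  by case: y => // e y _; move: Hc; rewrite andbT.
Qed.

(** A star leaves the subtree of its centre only along the arriving edge. The star of [[:: c]]
    contains a right germ below [prev c], so [Q] has to contain one; the vertex [[:: prev c]] has to
    be excluded, since its star reaches below [prev (prev c)]. *)
Lemma word_open_around (P Q : pred word) w :
  word_open (fun x => P x) -> word_open (fun x => Q x) -> ~~ Q [::] ->
  (exists J, forall x, right_germ J x -> Q x) ->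
  word_open (fun x => around P Q w x).
Proof.
move=> oP oQ Q0 [J1 HQ]; elim: w => [|c w IH] // [|d v] //=.
case: w IH => [_|e w IH].
  case: v => [|f v].
    rewrite (negbTE Q0) andbF orbF => /andP[/eqP-> P0].
    have [J2 HP] := oP [::] P0.
    exists (maxn J1 J2) => -[|e x] //= /orP[]/andP[-> H] /=.
      by rewrite HP //; apply: left_germ_le H; rewrite leq_maxr.
    by rewrite HQ ?orbT //; apply: right_germ_le H; rewrite leq_maxl.
  case/orP => /andP[dc H].
    have [J HJ] := oP _ H; exists J => x /around_cons2[y -> Hy].
    by rewrite dc HJ.
  have [J HJ] := oQ _ H; exists J => x /around_cons2[y -> Hy].
  by rewrite dc HJ ?orbT.
case/andP => dc; case: v => // f v /IH[J HJ].
by exists J => x /around_cons2[y -> Hy]; apply/andP; split=> //; exact: HJ.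
Qed.

Lemma around_right_germ (P Q : pred word) c w :
  exists J, forall x, right_germ J x -> ~~ around P Q (c :: w) x.
Proof.
exists `|c.2|.+1%N => -[|d x] //= H.
have /negbTE dc : d != c by apply: contraTneq H => ->; lia.
have /negbTE dp : d != prev c.
  by apply: contraTneq H => ->; rewrite /prev /=; lia.
by rewrite dc dp; case: w.
Qed.

(** The delicate points outside the set are [[:: prev c]], near which [Q] fails because it fails
    near [[::]], and the vertex following [c], whose arriving edge starts at [c] and has a right
    germ missed by [P]. *)
Lemma word_open_aroundC (P Q : pred word) w :
  word_open (fun x => ~~ P x) -> word_open (fun x => ~~ Q x) ->
  P [::] -> ~~ Q [::] ->
  (exists J, forall x, right_germ J x -> ~~ P x) ->
  word_open (fun x => ~~ around P Q w x).
Proof.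
move=> oP oQ P0 Q0 [J1 HP]; elim: w => [|c w IH] //.
have far (x : word) : left_germ `|c.2|.+1 x -> ~~ around P Q (c :: w) x.
  case: x => [|d x] //= H.
  have /negbTE dc : d != c by apply: contraTneq H => ->; lia.
  have /negbTE dp : d != prev c.
    by apply: contraTneq H => ->; rewrite /prev /=; lia.
  by rewrite dc dp; case: w {IH}.
case=> [|d v]; first by exists `|c.2|.+1%N.
case: w IH {far} => [_|e w IH] /=.
  case: v => [|f v].
    rewrite P0 (negbTE Q0) andbT andbF orbF => dc.
    have [J2 HQ] := oQ _ Q0.
    exists (maxn J1 J2) => -[|e x] //= /orP[]/andP[/eqP-> H].
      rewrite (negbTE dc) /=; case: eqP => //= _.
      by apply: HQ; apply: left_germ_le H; rewrite leq_maxr.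
    rewrite prevK (negbTE dc) /= orbF; case: eqP => //= _.
    by apply: HP; apply: right_germ_le H; rewrite leq_maxl.
  case: (eqVneq d c) => [->|dc] /=.
    rewrite neq_prev orbF => H; have [J HJ] := oP _ H.
    exists J => x /around_cons2[y -> Hy].
    by rewrite eqxx neq_prev /= orbF; apply: HJ.
  case: (eqVneq d (prev c)) => [->|dp] /=.
    move=> H; have [J HJ] := oQ _ H.
    exists J => x /around_cons2[y -> Hy].
    by rewrite eqxx prev_neq /=; apply: HJ.
  move=> _; exists 0%N => x /around_cons2[y -> Hy].
  by rewrite (negbTE dc) (negbTE dp).
case: v => [|f v] H.
  have [J2 H2] := IH [::] isT.
  have [J3 H3] := around_right_germ P Q e w.
  exists (maxn J2 J3) => -[|g x] //= /orP[]/andP[/eqP-> G].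
    rewrite negb_and; apply/orP; right.
    by apply: H2; apply: left_germ_le G; rewrite leq_maxl.
  rewrite negb_and; apply/orP; right.
  by apply: H3; apply: right_germ_le G; rewrite leq_maxr.
move: H; case: (eqVneq d c) => [->|dc] /=.
  move=> H; have [J HJ] := IH (f :: v) H.
  exists J => x /around_cons2[y -> Hy].
  by rewrite eqxx /=; apply: HJ.
move=> _; exists 0%N => x /around_cons2[y -> Hy].
by rewrite (negbTE dc).
Qed.

(** The star of a word of length at least two keeps the first letter, which gives the induction. At
    [[:: c]], level 1 puts the left germ before and the right germ after position 0 of their edges,
    so both fall on the same side of the cut as the vertex. *)
Lemma cut_locally_constant n v :
  exists J, forall x, star J v x -> cut n x = cut n v.
Proof.
elim: v n => [|c [|d v] IH] n.
- by exists `|n|.+1%N => -[|[l j] x] //=; rewrite /star /=; lia.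
- exists 1%N => -[|e x] //=; rewrite /star /= => /orP[]/andP[/eqP->] /=.
    by case: x => [|f x] //= Hf; have -> : (f.2 < 0)%R by lia.
  case: x => [|f x] //= Hf.
  have -> : (f.2 < 0)%R = false by lia.
  have -> : (f.2 == 0%R) = false by lia.
  by lia.
- have [J HJ] := IH 0%R.
  by exists J => x /around_cons2[y -> Hy]; rewrite [LHS]/= HJ.
Qed.

Lemma word_open_cut n : word_open (fun x => cut n x).
Proof.
by move=> v; have [J HJ] := cut_locally_constant n v; exists J => x /HJ /= ->.
Qed.

Lemma word_open_cutC n : word_open (fun x => ~~ cut n x).
Proof.
by move=> v; have [J HJ] := cut_locally_constant n v; exists J => x /HJ /= ->.
Qed.

Lemma word_open_star J w : word_open (fun x => star J w x).
Proof.
apply: word_open_around => //; [exact: word_open_left_germ| |by exists J].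
exact: word_open_right_germ.
Qed.

Lemma word_open_clopen_star J w : word_open (fun x => clopen_star J w x).
Proof.
apply: word_open_around => //; [exact: word_open_cut|exact: word_open_cutC|].
by exists J.+1 => -[|c x] //= H; lia.
Qed.

Lemma word_open_clopen_starC J w : word_open (fun x => ~~ clopen_star J w x).
Proof.
apply: word_open_aroundC => //; first exact: word_open_cutC.
  move=> v H; have [K HK] := cut_locally_constant J v; exists K => x /HK /= ->.
  exact: H.
by exists 1%N => -[|c x] //= H; lia.
Qed.

(** The level drops by one because of the left end: [cut (- J)] still contains the vertices of index
    [- J]. *)
Lemma clopen_star_star J w x : clopen_star J.+1 w x -> star J w x.
Proof.
apply: around_sub => -[|c y] //=; first lia.
case: y => [|d y] /=; lia.
Qed.

Lemma star_separated w x : x != w -> exists J, ~~ star J w x.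
Proof.
elim: w x => [|c w IH] [|d x] //=; try by exists 0%N.
  by move=> _; exists `|d.2|%N; rewrite /star /=; lia.
case: w IH => [_|e w IH]; rewrite ?eqseq_cons => H.
  case: x H => [|f x] H.
    exists 0%N; rewrite /star /= andbF orbF.
    by move: H; rewrite !andbT => /negbTE->.
  exists `|f.2|.+1%N; rewrite /star /=; apply/negP => /orP[]/andP[_]; lia.
case: (eqVneq d c) H => [->|dc] /= H.
  by have [J HJ] := IH _ H; exists J; rewrite /star /= eqxx.
by exists 0%N; rewrite /star /= (negbTE dc).
Qed.

(** * Shifts of one arc inside an edge *)

Fixpoint shift (u : word) (l : nat) (d : int) (x : word) : word :=
  if x is c :: y then
    if u is e :: u' then if c == e then c :: shift u' l d y else x
    else (if c.1 == l then (l, (c.2 + d)%R) else c) :: y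
  else [::].

Lemma shift0 u l x : shift u l 0 x = x.
Proof.
elim: u x => [|e u IH] [|[k j] x] //=; last by rewrite IH if_same.
by rewrite addr0; case: eqP => // ->.
Qed.

Lemma shiftD u l d d' x : shift u l d (shift u l d' x) = shift u l (d + d') x.
Proof.
elim: u x => [|e u IH] [|[k j] x] //=.
  case: (eqVneq k l) => [_|kl] /=; last by rewrite (negbTE kl).
  by rewrite eqxx -addrA [(d' + d)%R]addrC.
case: (eqVneq (k, j) e) => [ke|ke] /=; first by rewrite ke eqxx IH.
by rewrite (negbTE ke).
Qed.

Lemma shift_nil u l d : shift u l d [::] = [::]. Proof. by case: u. Qed.

Lemma shift_eq0 u l d x : (shift u l d x == [::]) = (x == [::]).
Proof. by case: x u => [|c x] [|e u] //=; case: ifP. Qed.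

Lemma left_germ_shift u l d J x :
  left_germ (J + `|d|) x -> left_germ J (shift u l d x).
Proof.
by case: u x => [|e u] [|[k j] x] //=; case: eqP => //= _; lia.
Qed.

Lemma right_germ_shift u l d J x :
  right_germ (J + `|d|) x -> right_germ J (shift u l d x).
Proof.
case: u x => [|e u] [|[k j] x] //=;
  [case: (k == l) | case: (_ == e)] => /=; rewrite ?shift_eq0;
  by case: (x == [::]) => /=; lia.
Qed.

(** A shift commutes with [prev] along the moved arc, hence maps edges to edges, and inside an edge
    it changes indices by at most [|d|]. *)
Lemma star_shift u l d J v x :
  star (J + `|d|) v x -> star J (shift u l d v) (shift u l d x).
Proof.
elim: v u x => [|c v IH] u x; first by rewrite shift_nil; apply: left_germ_shift.
case: v IH => [_|e v IH].
  case: x => [|f x] //= /orP[]/andP[/eqP-> H].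
    case: u => [|g u] /=.
      case: eqP => _; rewrite /star /= eqxx (@left_germ_le _ (J + `|d|)) //;
      by rewrite leq_addr.
    case: eqP => _; rewrite /star ?shift_nil /= eqxx /=.
      by rewrite left_germ_shift.
    by rewrite (@left_germ_le _ (J + `|d|)) // leq_addr.
  have H' := right_germ_le (leq_addr `|d| J) H.
  case: u => [|g u] /=.
    case: eqP => _; rewrite /star /prev /= ?H'; apply/orP; right.
      by rewrite andbT; apply/eqP; congr (_, _) => /=; lia.
    by rewrite eqxx.
  case: (eqVneq c g) => cg; rewrite /star ?shift_nil /=.
    rewrite -cg prev_neq /=; apply/orP; right; by rewrite eqxx H'.
  case: eqP => _ /=; rewrite eqxx /= ?right_germ_shift ?H' ?orbT //.
move=> /around_cons2[y -> Hy].
case: u => [|g u] /=.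
  rewrite /star; case: eqP => _; rewrite [around _ _ _ _]/= eqxx andTb;
  by apply: around_sub Hy => z; [apply: left_germ_le|apply: right_germ_le];
     rewrite leq_addr.
case: eqP => _.
  have := IH u y Hy; have : shift u l d (e :: v) != [::] by rewrite shift_eq0.
  rewrite /star [X in _ -> _ -> X]/=.
  by case: (shift u l d (e :: v)) => //= *; rewrite eqxx.
rewrite /star [around _ _ _ _]/= eqxx andTb.
by apply: around_sub Hy => z; [apply: left_germ_le|apply: right_germ_le];
     rewrite leq_addr.
Qed.

(* For fixed [u] and [j], [B] contains or misses the interior of almost every edge
   [u ++ [:: (l, j)]]. *)
Definition eventually_saturated (B : set word) := forall u j,
  exists L, forall l, (L <= l)%N ->
    forall x y, x != [::] -> y != [::] ->
      B (u ++ (l, j) :: x) <-> B (u ++ (l, j) :: y).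

Lemma shift_saturated u l d B :
  eventually_saturated B -> eventually_saturated (shift u l d @^-1` B).
Proof.
move=> satB v j.
(* For almost all [k] the shift changes at most the prefix [v]: it neither moves the arc [k] nor
   enters the subtree at [(k, j)]. *)
have [v' [L HL]] : exists v' L, forall k x, (L <= k)%N ->
    shift u l d (v ++ (k, j) :: x) = v' ++ (k, j) :: x.
  elim: u v => [|e u IH] [|c v] /=.
  - by exists [::], l.+1 => k x; case: eqP => // ->; rewrite ltnn.
  - by exists ((if c.1 == l then (l, (c.2 + d)%R) else c) :: v), 0%N.
  - exists [::], e.1.+1 => k x; case: eqP => // <- /=; by rewrite ltnn.
  - case: eqP => _; last by exists (c :: v), 0%N.
    by have [v' [L HL]] := IH v; exists (c :: v'), L => k x /HL ->.
have [L' HL'] := satB v' j.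
exists (maxn L L') => k; rewrite geq_max => /andP[Lk Lk'] x y x0 y0.
by rewrite /preimage /= !HL //; apply: HL'.
Qed.

(** Beyond the arcs named in [w], membership depends on what follows [(l, j)] only through the
    emptiness test in [right_germ]; hence the restriction to nonempty [x] and [y]. *)
Lemma star_saturated J w : eventually_saturated (fun x => star J w x).
Proof.
suff main u j : exists L, forall l, (L <= l)%N ->
    forall x y, x != [::] -> y != [::] ->
      star J w (u ++ (l, j) :: x) = star J w (u ++ (l, j) :: y).
  move=> u j; have [L HL] := main u j.
  by exists L => l /HL{}HL x y x0 y0; rewrite /= (HL x y).
elim: w u => [|c w IH] [|d u] /=; try by exists 0%N.
  exists c.1.+1 => l cl x y _ _; rewrite /star /prev.
  have /negbTE dc : (l, j) != c by apply: contraTneq cl => <-; rewrite ltnn.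
  have /negbTE dp : (l, j) != (c.1, (c.2 - 1)%R) by rewrite xpair_eqE negb_and; lia.
  by rewrite /= dc dp; case: (w).
case: w IH => [_|e w IH].
  exists 0%N => l _ x y x0 y0; rewrite /star /=.
  case: u => [|f u] /=; first by rewrite x0 y0.
  by congr (_ || _); congr (_ && _); case: u.
have [L HL] := IH u; exists L => l /HL{}HL x y x0 y0.
exact: (congr1 (andb (d == c)) (HL x y x0 y0)).
Qed.

Lemma shift_support v l d x :
  shift v l d x = x \/
  exists y z, [/\ y != [::], z != [::], x = v ++ y & shift v l d x = v ++ z].
Proof.
elim: v x => [|e v IH] [|c x] //=; try by left.
  right; exists (c :: x), ((if c.1 == l then (l, (c.2 + d)%R) else c) :: x).
  by split.
case: eqP => [->|_]; last by left.
have [->|[y [z [y0 z0 -> ->]]]] := IH x; first by left.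
by right; exists y, z.
Qed.

Lemma shift_cat v c l d x :
  shift v l d (v ++ c :: x) = v ++ (if c.1 == l then (l, (c.2 + d)%R) else c) :: x.
Proof. by elim: v => [|e v IH] //=; rewrite eqxx IH. Qed.

(** * Countable crowded spaces *)

(* The spaces [T] homeomorphic to the tree [seq nat] in which a neighbourhood of
   [s] contains all but finitely many of the subtrees at the children of [s]. *)
Definition tree_space (T : topologicalType) := exists2 h : seq nat -> T,
  bijective h &
  forall s U, nbhs (h s) U <->
    U (h s) /\ exists k, forall n t, (k <= n)%N -> U (h (s ++ n :: t)).

Lemma tree_space_homeomorphic (S T : topologicalType) :
  tree_space S -> tree_space T ->
  exists f : S -> T, exists2 g : T -> S,
    cancel f g /\ cancel g f & continuous f /\ continuous g.
Proof.
move=> [h [h' hK h'K] nbh] [k [k' kK k'K] nbk].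
exists (k \o h'), (h \o k'); split.
- by move=> x /=; rewrite kK h'K.
- by move=> x /=; rewrite hK k'K.
- move=> x U /=; rewrite -(h'K x) hK => /nbk[Us [n HU]].
  by apply/nbh => /=; rewrite hK; split=> //; exists n => m t /HU; rewrite hK.
- move=> x U /=; rewrite -(k'K x) kK => /nbh[Us [n HU]].
  by apply/nbk => /=; rewrite kK; split=> //; exists n => m t /HU; rewrite kK.
Qed.

Section CountableCrowded.
Variables (T : topologicalType) (num : T -> nat) (C : T -> nat -> set T).
Hypotheses (num_inj : injective num)
  (C_clopen : forall x n, clopen (C x n))
  (C_self : forall x n, C x n x)
  (C_basis : forall x U, nbhs x U -> exists n, C x n `<=` U)
  (C_separated : forall x y, y <> x -> exists n, ~ C x n y)
  (crowded : forall x n, exists2 y, C x n y & y <> x).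

(** Since the space is crowded, a second point can be cut off, which keeps the difference
    nonempty. *)
Let clopen_refine (D : set T) x n : clopen D -> D x ->
  exists E, [/\ clopen E, E x, E `<=` D, E `<=` C x n & D `\` E !=set0].
Proof.
move=> cD Dx.
have [m Cm] : exists m, C x m `<=` D `&` C x n.
  apply: C_basis; apply: filterI; apply: open_nbhs_nbhs; split=> //.
    by case: cD.
  by case: (C_clopen x n).
have [y Cy yx] := crowded x m; have [k Ck] := C_separated yx.
have [Dy Cny] := Cm _ Cy.
exists (C x m `&` C x k); split.
- by apply: clopenI.
- by split.
- by move=> z [/Cm[]].
- by move=> z [/Cm[]].
- by exists y; split=> // -[].
Qed.

(* Centring each cell at its point of least number makes every point the centre
   of some cell, since the numbers of the centres increase along a branch. *)
Definition splitting (D : set T) (p : T * (nat -> set T)) :=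
  let: (x, P) := p in
  [/\ D x /\ (forall y, D y -> (num x <= num y)%N),
      forall n, clopen (P n) /\ P n !=set0,
      forall y, (D y /\ y <> x) <-> exists n, P n y,
      forall n m y, P n y -> P m y -> n = m
    & forall U, nbhs x U -> exists k, forall n, (k <= n)%N -> P n `<=` U].

(** The pieces are the differences of consecutive members of a strictly decreasing sequence of
    clopen neighbourhoods of the centre that shrinks to it. *)
Let exists_splitting D : clopen D -> D !=set0 -> exists p, splitting D p.
Proof.
move=> cD D0.
have [x [Dx xmin]] : exists x, D x /\ forall y, D y -> (num x <= num y)%N.
  have ex : exists n, `[< exists2 x, D x & num x = n >].
    by case: D0 => x Dx; exists (num x); apply/asboolP; exists x.
  case: (ex_minnP ex) => n /asboolP[x Dx <-] nmin; exists x; split=> // y Dy.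
  by apply: nmin; apply/asboolP; exists y.
have /choice[next nextP] : forall p : set T * nat, exists E,
    clopen p.1 -> p.1 x ->
    [/\ clopen E, E x, E `<=` p.1, E `<=` C x p.2 & p.1 `\` E !=set0].
  move=> [E n] /=; have [[cE Ex]|nE] := pselect (clopen E /\ E x).
    by have [F HF] := clopen_refine n cE Ex; exists F.
  by exists setT => cE Ex; case: nE.
pose U := fix U n := if n is m.+1 then next (U m, m) else D.
have UP n : clopen (U n) /\ U n x.
  by elim: n => [|n [cU Ux]] //=; have [] := nextP (U n, n) cU Ux.
have US n : [/\ U n.+1 `<=` U n, U n.+1 `<=` C x n & U n `\` U n.+1 !=set0].
  by have [cU Ux] := UP n; have [] := nextP (U n, n) cU Ux.
have Ule n m : (n <= m)%N -> U m `<=` U n.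
  elim: m => [|m IH]; first by rewrite leqn0 => /eqP->.
  rewrite leq_eqVlt => /predU1P[->//|/IH nm].
  by case: (US m) => mm _ _; apply: subset_trans nm.
exists (x, fun n => U n `\` U n.+1); split=> //.
- move=> n; split; last by case: (US n).
  rewrite /= setDE; apply: clopenI; first by case: (UP n).
  by case: (UP n.+1) => + _; apply: clopenC.
- move=> y; split=> [[Dy yx]|[n [Uy nUy]]]; last first.
    split; first exact: (Ule 0%N n).
    by move=> yx; apply: nUy; rewrite yx; case: (UP n.+1).
  have [k Ck] := C_separated yx.
  have ex : exists n, ~~ `[< U n y >].
    by exists k.+1; apply/asboolPn => Uy; apply: Ck; case: (US k) => _ + _; apply.
  case: (ex_minnP ex) => -[|n] /asboolPn nU nmin; first by case: nU.
  exists n; split=> //; apply: contrapT => nUn.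
  by have := nmin n; rewrite ltnn => H; apply: notF; apply: H; apply/asboolPn.
- move=> n m y [Un nUn] [Um nUm]; apply/eqP; rewrite eqn_leq.
  rewrite leqNgt (leqNgt m); apply/andP; split; apply/negP => nm.
    by apply: nUm; apply: Ule nm _ Un.
  by apply: nUn; apply: Ule nm _ Um.
- move=> V /C_basis[k Ck]; exists k.+1 => n kn y [Uy _]; apply: Ck.
  by case: (US k) => _ + _; apply; apply: Ule kn _ Uy.
Qed.

(** A form of Sierpinski's characterization of the rationals: the whole space is split, then each
    piece, and so on, and a sequence of naturals names the centre of the cell to which it leads. *)
Lemma countable_crowded_tree_space : [set: T] !=set0 -> tree_space T.
Proof.
move=> T0.
have /choice[sp spP] : forall D : set T, exists p,
    clopen D -> D !=set0 -> splitting D p.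
  move=> D; have [[cD D0]|nD] := pselect (clopen D /\ D !=set0).
    by have [p Hp] := exists_splitting cD D0; exists p.
  by case: T0 => x _; exists (x, fun=> set0) => cD D0; case: nD.
pose h := fix h (D : set T) (s : seq nat) :=
  if s is n :: s' then h ((sp D).2 n) s' else (sp D).1.
have spE D : clopen D -> D !=set0 -> splitting D ((sp D).1, (sp D).2).
  by move=> cD D0; have := spP D cD D0; case: (sp D).
have hD s D : clopen D -> D !=set0 -> D (h D s).
  elim: s D => [|n s IH] D cD D0; have [[c1 _] c2 c3 _ _] := spE D cD D0 => //=.
  have [/IH/[apply] H] := c2 n.
  by have [] : D (h ((sp D).2 n) s) /\ h ((sp D).2 n) s <> (sp D).1
    by apply/c3; exists n.
have h_inj s t D : clopen D -> D !=set0 -> h D s = h D t -> s = t.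
  elim: s t D => [|n s IH] [|m t] D cD D0 //=;
    have [_ c2 c3 c4 _] := spE D cD D0.
  - have [cm /hD-/(_ t cm) Hm] := c2 m => E.
    by have [_ []] : D (h ((sp D).2 m) t) /\ h ((sp D).2 m) t <> (sp D).1
      by apply/c3; exists m.
  - have [cm /hD-/(_ s cm) Hm] := c2 n => E.
    by have [_ []] : D (h ((sp D).2 n) s) /\ h ((sp D).2 n) s <> (sp D).1
      by apply/c3; exists n.
  - have [cn n0] := c2 n; have [cm m0] := c2 m => E.
    have nm : n = m.
      by apply: (c4 n m (h ((sp D).2 n) s)); [exact: hD|rewrite E; exact: hD].
    by rewrite -{}nm {m cm m0} in E *; rewrite (IH _ _ cn n0 E).
have h_surj y D : clopen D -> D y -> exists s, h D s = y.
  move=> cD Dy; have [k] : exists k, (num y < k + num (sp D).1)%N.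
    by exists (num y).+1; lia.
  elim: k D cD Dy => [|k IH] D cD Dy;
    have [[c1 cmin] c2 c3 _ _] := spE D cD (ex_intro _ y Dy) => Hk.
    by have := cmin y Dy; lia.
  have [->|yx] := pselect (y = (sp D).1); first by exists [::].
  have [n Hn] : exists n, (sp D).2 n y by apply/c3.
  have [cn n0] := c2 n.
  suff [s <-] : exists s, h ((sp D).2 n) s = y by exists (n :: s).
  apply: IH => //.
  have [Dc cx] : D (sp ((sp D).2 n)).1 /\ (sp ((sp D).2 n)).1 <> (sp D).1.
    by apply/c3; exists n; exact: (hD [::]).
  have : num (sp ((sp D).2 n)).1 <> num (sp D).1 by move/num_inj.
  by have := cmin _ Dc; lia.
have nbh s U D : clopen D -> D !=set0 -> nbhs (h D s) U <->
    U (h D s) /\ exists k, forall n t, (k <= n)%N -> U (h D (s ++ n :: t)).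
  elim: s D => [|n s IH] D cD D0; have [[c1 _] c2 c3 _ c5] := spE D cD D0; last first.
    by have [cn n0] := c2 n; exact: IH.
  split=> [HU|[Uc [k HU]]].
    split; first exact: nbhs_singleton HU.
    have [k Hk] := c5 U HU; exists k => n t kn.
    by have [cn n0] := c2 n => /=; apply: (Hk n kn); exact: hD.
  (* Removing the first [k] pieces from [D] leaves the centre and the pieces of index at least [k],
     all inside [U]. *)
  suff : open (D `&` \bigcap_(n in `I_k) ~` (sp D).2 n).
    move=> oA; rewrite nbhsE; exists (D `&` \bigcap_(n in `I_k) ~` (sp D).2 n).
      split=> //; split=> // n _ Hn.
      by have [_ []] : D (sp D).1 /\ (sp D).1 <> (sp D).1 by apply/c3; exists n.
    move=> y [Dy Hy]; have [->//|yx] := pselect (y = (sp D).1).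
    have [n Hn] : exists n, (sp D).2 n y by apply/c3.
    have [cn n0] := c2 n; have [t <-] := h_surj y _ cn Hn.
    by apply: (HU n t); rewrite leqNgt; apply/negP => nk; exact: (Hy n nk).
  apply: openI; first by case: cD.
  rewrite -setC_bigcup; apply: closed_openC; apply: closed_bigcup => //.
  by move=> i _; case: (c2 i) => -[].
have cT : clopen [set: T] by split; [exact: openT|exact: closedT].
exists (h setT); last by move=> s U; exact: nbh.
have /choice[g gP] : forall y, exists s, h setT s = y by move=> y; exact: h_surj.
exists g => // s; apply: (h_inj _ _ setT) => //.
Qed.

End CountableCrowded.

(** * The rationals as a tree space *)

Lemma sqr_rat_neq2 (a : rat) : (a ^+ 2 != 2)%R.
Proof.
apply/eqP => a2.
have d0 : ((denq a)%:~R != 0 :> rat)%R by rewrite intr_eq0 denq_neq0.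
have : (numq a ^+ 2 = 2 * denq a ^+ 2)%R.
  apply: (@intr_inj rat).
  by rewrite !expr2 !intrM !numqE mulrACA -expr2 a2.
move=> /(congr1 absz); rewrite abszM !abszX => E.
(* The exponent of 2 is even on the left and odd on the right. *)
have := congr1 (logn 2) E.
rewrite lognM ?expn_gt0 ?absz_gt0 ?denq_neq0 // !lognX.
have -> : logn 2 `|2%R| = 1%N by [].
lia.
Qed.

(** The interval about [x] of radius [sqrt 2 / (n + 1)], written with squares to stay in the
    rationals; its irrational endpoints make it clopen. *)
Definition rat_interval (x : rat^o) (n : nat) : set rat^o :=
  [set q | (n.+1%:R ^+ 2 * (q - x) ^+ 2 < 2)%R].

Lemma clopen_rat_interval x n : clopen (rat_interval x n).
Proof.
pose f : rat^o -> rat^o := fun q => (n.+1%:R ^+ 2 * (q - x) ^+ 2)%R.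
have cf : continuous f.
  have cB : continuous (fun q : rat^o => (q - x)%R).
    by move=> q; apply: cvgB; [exact: cvg_id|exact: cvg_cst].
  move=> q; have cBB := cvgM (cB q) (cB q).
  exact: (cvgM (@cvg_cst rat^o (n.+1%:R ^+ 2)%R _ (nbhs q) _) (cBB _)).
split.
  exact: (open_comp (fun q _ => cf q) (@open_lt _ (2 : rat)%R)).
have -> : rat_interval x n = f @^-1` [set y | (y <= 2)%R].
  apply/seteqP; split=> q /=; rewrite /rat_interval /= -/(f q); first exact: ltW.
  rewrite le_eqVlt => /predU1P[] //.
  by rewrite /f -exprMn => /eqP; rewrite (negbTE (sqr_rat_neq2 _)).
exact: (closed_comp (fun q _ => cf q) (@closed_le _ (2 : rat)%R)).
Qed.

Lemma rat_tree_space : tree_space rat^o.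
Proof.
have basis (x : rat^o) U : nbhs x U -> exists n, rat_interval x n `<=` U.
  move=> /nbhs_ballP[e /= e0 HU].
  pose n := Num.bound (2 / e)%R; exists n => q; rewrite /rat_interval /= => Hq.
  apply: HU; rewrite /ball /= distrC ltNge; apply/negP => eq.
  have : (2 / e < n.+1%:R)%R.
    by apply: lt_trans (archi_boundP _) _; [rewrite divr_ge0 // ltW|rewrite ltr_nat].
  rewrite ltr_pdivrMr // => n2.
  have : (2 < n.+1%:R * `|q - x|)%R.
    by apply: lt_le_trans n2 _; rewrite ler_pM2l ?ltr0n.
  move: Hq; rewrite -[((q - x) ^+ 2)%R]real_normK ?num_real // -exprMn.
  by move: (n.+1%:R * `|q - x|)%R => a; nra.
apply: (@countable_crowded_tree_space rat^o (@pickle rat) rat_interval) => //.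
- exact: clopen_rat_interval.
- by move=> x n; rewrite /rat_interval /= subrr expr0n mulr0.
- move=> x y yx; have [n Hn] : exists n, rat_interval x n `<=` ball x `|x - y|%R.
    apply: basis; apply: nbhsx_ballx.
    by rewrite normr_gt0 subr_eq0 eq_sym; apply/eqP.
  by exists n => /Hn; rewrite /ball /= ltxx.
- move=> x n; exists (x + n.+1%:R^-1)%R.
    by rewrite /rat_interval /= [(x + _ - x)%R]addrAC subrr add0r -exprMn mulfV ?expr1n.
  by move/eqP; rewrite -subr_eq0 addrAC subrr add0r invr_eq0 pnatr_eq0.
- by exists 0%R.
Qed.

(** * The space of words *)

Lemma word_nbhs_filter (w : word) :
  ProperFilter (filter_from setT (star ^~ w : nat -> set word)).
Proof.
apply: filter_from_proper; last by move=> J _; exists w; exact: star_self.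
apply: filter_fromT_filter; first by exists 0%N.
move=> i j; exists (maxn i j) => x Hx.
by split; apply: star_le Hx; rewrite ?leq_maxl ?leq_maxr.
Qed.

Lemma word_nbhs_singleton (w : word) (A : set word) :
  filter_from setT (star ^~ w : nat -> set word) A -> A w.
Proof. by move=> [J _]; apply; exact: star_self. Qed.

Lemma word_nbhs_nbhs (w : word) (A : set word) :
  filter_from setT (star ^~ w : nat -> set word) A ->
  filter_from setT (star ^~ w : nat -> set word)
    (fun v => filter_from setT (star ^~ v : nat -> set word) A).
Proof.
move=> [J _ HJ]; exists J => // v /(@word_open_star J w)[K HK].
by exists K => // x /HK; apply: HJ.
Qed.

HB.instance Definition _ := hasNbhs.Build word
  (fun w : word => filter_from setT (star ^~ w : nat -> set word)).
HB.instance Definition _ := Nbhs_isNbhsTopological.Build word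
  word_nbhs_filter word_nbhs_singleton word_nbhs_nbhs.

Lemma word_nbhsE (w : word) (A : set word) :
  nbhs w A <-> exists J, forall x, star J w x -> A x.
Proof. by split=> [[J _ HJ]|[J HJ]]; exists J. Qed.

Lemma word_openP (A : set word) : word_open A -> open A.
Proof. by move=> oA; rewrite openE => v /oA Hv; apply/word_nbhsE. Qed.

Lemma word_tree_space : tree_space word.
Proof.
have clo w J : clopen (clopen_star J w : set word).
  split; first exact/word_openP/word_open_clopen_star.
  rewrite -[X in closed X]setCK; apply: open_closedC; apply: word_openP => v.
  move=> /negP Hv; have [K HK] := @word_open_clopen_starC J w v Hv.
  by exists K => x /HK /negP.
apply: (@countable_crowded_tree_space word (@pickle word)
  (fun w J => clopen_star J w)) => //.
- by move=> w J; apply: around_self.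
- move=> w U /word_nbhsE[J HJ]; exists J.+1 => x Hx; apply: HJ.
  exact: clopen_star_star.
- move=> w x /eqP /star_separated[J HJ]; exists J.+1 => Hx.
  by move/negP: HJ; apply; exact: clopen_star_star.
- move=> w J; exists (w ++ [:: (0%N, (- J.+1%:Z)%R)]).
    by apply: around_cat => /=; lia.
  by move/(congr1 size); rewrite size_cat /=; lia.
- by exists [::].
Qed.

(** * Metrics from a decreasing sequence of equivalence relations *)

Section AgreementMetric.
Variables (R : realType) (T : topologicalType) (agree : nat -> T -> T -> Prop).
Hypotheses (agreexx : forall n x, agree n x x)
  (agree_sym : forall n x y, agree n x y -> agree n y x)
  (agree_trans : forall n x y z, agree n x y -> agree n y z -> agree n x z)
  (agree_le : forall n m x y, (n <= m)%N -> agree m x y -> agree n x y)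
  (agree_separated : forall x y, x <> y -> exists n, ~ agree n x y)
  (agree_nbhs : forall x U, nbhs x U <-> exists n, agree n x `<=` U).

Lemma agreement_hausdorff : hausdorff_space T.
Proof.
move=> x y clxy; apply: contrapT => /agree_separated[n]; apply.
have [z [xz yz]] : agree n x `&` agree n y !=set0.
  by apply: clxy; apply/agree_nbhs; exists n.
exact: agree_trans xz (agree_sym yz).
Qed.

(** The distance is [1 / (k + 1)], with [k] the first index at which the points disagree. It is an
    ultrametric, since a disagreement of [x] and [z] at [n] forces one of [x], [y] or of [y], [z] at
    [n]. *)
Lemma agreement_metrizable : metrizable R T.
Proof.
have /choice[d dP] : forall p : T * T, exists e : R,
    [/\ (0 <= e)%R, e = 0%R <-> p.1 = p.2,
        forall n, (e < n.+1%:R^-1)%R <-> agree n p.1 p.2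
      & e = 0%R \/ exists n, e = n.+1%:R^-1%R].
  move=> [x y] /=; have [->|xy] := pselect (x = y).
    exists 0%R; split; [exact: lexx|by []| |by left] => n.
    by rewrite invr_gt0 ltr0n; split.
  have ex : exists n, ~~ `[< agree n x y >].
    by have [n Hn] := agree_separated xy; exists n; apply/asboolPn.
  case: (ex_minnP ex) => k /asboolPn nk kmin; exists (k.+1%:R^-1)%R; split.
  - by rewrite invr_ge0.
  - by split=> // /eqP; rewrite invr_eq0 pnatr_eq0.
  - move=> n; rewrite ltf_pV2 ?posrE ?ltr0n // ltr_nat ltnS; split=> [nk'|an].
      apply: contrapT => nn; have := kmin n; rewrite leqNgt nk' => H.
      by apply: notF; apply: H; apply/asboolPn.
    by rewrite ltnNge; apply/negP => kn; apply: nk; exact: agree_le an.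
  - by right; exists k.
have dle x y n : ~ agree n x y -> (n.+1%:R^-1 <= d (x, y))%R.
  move=> nag; rewrite leNgt; apply/negP => lt; apply: nag.
  by have [_ _ H _] := dP (x, y); exact/H.
exists (fun x y => d (x, y)); split.
- by move=> x y; have [_ ? _ _] := dP (x, y).
- have le x y : (d (x, y) <= d (y, x))%R.
    have [d0 _ H [->|[n E]]] := dP (x, y); first by have [] := dP (y, x).
    rewrite E; apply: dle => /agree_sym /H; by rewrite E ltxx.
  by move=> x y; apply/eqP; rewrite eq_le !le.
- move=> x y z; have [xy0 _ _ _] := dP (x, y); have [yz0 _ _ _] := dP (y, z).
  have [_ _ H [->|[n E]]] := dP (x, z); first exact: addr_ge0.
  have : ~ agree n x z by move/H; rewrite E ltxx.
  have [axy|nxy] := pselect (agree n x y).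
    move=> nxz; have : ~ agree n y z by move=> ayz; apply: nxz; exact: agree_trans ayz.
    by move=> /dle; rewrite -E => /le_trans; apply; rewrite lerDr.
  by move=> _; move: nxy => /dle; rewrite -E => /le_trans; apply; rewrite lerDl.
- move=> x; apply/seteqP; split=> U.
    move=> /agree_nbhs[n Hn]; exists (n.+1%:R^-1)%R; first by rewrite /= invr_gt0 ltr0n.
    by move=> y /= Hy; apply: Hn; have [_ _ H _] := dP (x, y); exact/H.
  move=> [e /= e0 He]; apply/agree_nbhs; exists (Num.bound e^-1) => y axy.
  apply: He => /=; have [_ _ H _] := dP (x, y); move/H: axy => /lt_trans; apply.
  rewrite invf_plt ?posrE ?ltr0n //.
  apply: lt_trans (archi_boundP _) _; first by rewrite invr_ge0 ltW.
  by rewrite ltr_nat.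
Qed.

End AgreementMetric.

(** * The group of shifts *)

Definition shift_code := (word * nat * int)%type.

Fixpoint eval (s : seq shift_code) (x : word) : word :=
  if s is (u, l, d) :: s' then shift u l d (eval s' x) else x.

Definition eval_inv (s : seq shift_code) : seq shift_code :=
  rev [seq (g.1, (- g.2)%R) | g <- s].

Lemma eval_cat s t x : eval (s ++ t) x = eval s (eval t x).
Proof. by elim: s => [|[[u l] d] s IH] //=; rewrite IH. Qed.

Lemma eval_invK s : cancel (eval s) (eval (eval_inv s)).
Proof.
elim: s => [|[[u l] d] s IH] x //=.
by rewrite /eval_inv /= rev_cons -cats1 eval_cat /= shiftD addNr shift0 IH.
Qed.

Lemma eval_invVK s : cancel (eval (eval_inv s)) (eval s).
Proof.
elim: s => [|[[u l] d] s IH] x //=.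
by rewrite /eval_inv /= rev_cons -cats1 eval_cat /= IH shiftD subrr shift0.
Qed.

(** The elements are maps rather than words in the generators, so the action is faithful; the words
    serve to count them. *)
Record shift_group := ShiftGroup {
  perm_of :> word -> word ;
  perm_ofP : `[< exists s, perm_of = eval s >]
}.
HB.instance Definition _ := [isSub for perm_of].
HB.instance Definition _ := [Choice of shift_group by <:].

Lemma shift_groupP (g : shift_group) : exists s, g = eval s :> (word -> word).
Proof. exact/asboolP/perm_ofP. Qed.

Definition of_code (s : seq shift_code) : shift_group :=
  ShiftGroup (asboolT (ex_intro (fun t => eval s = eval t) s erefl)).

Definition code_of (g : shift_group) : seq shift_code := sval (cid (shift_groupP g)).

Lemma code_ofE (g : shift_group) : g = eval (code_of g) :> (word -> word).
Proof. exact: svalP (cid (shift_groupP g)). Qed.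

Lemma code_ofK : cancel code_of of_code.
Proof. by move=> g; apply: val_inj; rewrite /= -code_ofE. Qed.

Lemma shift_group_ext (g h : shift_group) : g =1 h -> g = h.
Proof. by move=> gh; apply: val_inj; apply/funext. Qed.

Definition sg_one := of_code [::].
Definition sg_mul (g h : shift_group) := of_code (code_of g ++ code_of h).
Definition sg_inv (g : shift_group) := of_code (eval_inv (code_of g)).

Lemma sg_mulE (g h : shift_group) x : sg_mul g h x = g (h x).
Proof. by rewrite /= eval_cat -!code_ofE. Qed.

Lemma sg_invK (g : shift_group) x : sg_inv g (g x) = x.
Proof. by rewrite /= code_ofE eval_invK. Qed.

Lemma sg_invVK (g : shift_group) x : g (sg_inv g x) = x.
Proof. by rewrite /= code_ofE eval_invVK. Qed.

Lemma sg_mulA : associative sg_mul.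
Proof. by move=> f g h; apply: shift_group_ext => x; rewrite !sg_mulE. Qed.

Lemma sg_mul1 : left_id sg_one sg_mul.
Proof. by move=> g; apply: shift_group_ext => x; rewrite sg_mulE. Qed.

Lemma sg_mulr1 : right_id sg_one sg_mul.
Proof. by move=> g; apply: shift_group_ext => x; rewrite sg_mulE. Qed.

Lemma sg_mulV : left_inverse sg_one sg_inv sg_mul.
Proof. by move=> g; apply: shift_group_ext => x; rewrite sg_mulE sg_invK. Qed.

Lemma sg_mulVr : right_inverse sg_one sg_inv sg_mul.
Proof. by move=> g; apply: shift_group_ext => x; rewrite sg_mulE sg_invVK. Qed.

HB.instance Definition _ :=
  isGroup.Build shift_group sg_mulA sg_mul1 sg_mulr1 sg_mulV sg_mulVr.

Definition star_code := (seq shift_code * word * nat)%type.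

(** The countable base on which convergence is tested. Stars alone are not permuted by the group, so
    their preimages under all group elements are included. *)
Definition star_preim (i : star_code) : set word :=
  fun x => star i.2 i.1.2 (eval i.1.1 x).

Definition agree (n : nat) (g h : shift_group) := forall i : star_code,
  (pickle i < n)%N -> g @^-1` star_preim i = h @^-1` star_preim i.

Lemma agreexx n g : agree n g g. Proof. by []. Qed.

Lemma agree_sym n g h : agree n g h -> agree n h g.
Proof. by move=> gh i /gh ->. Qed.

Lemma agree_trans n f g h : agree n f g -> agree n g h -> agree n f h.
Proof. by move=> fg gh i ni; rewrite fg // gh. Qed.

Lemma agree_le n m g h : (n <= m)%N -> agree m g h -> agree n g h.
Proof. by move=> nm gh i ni; apply: gh; apply: leq_trans nm. Qed.

Lemma agree_separated (g h : shift_group) : g <> h -> exists n, ~ agree n g h.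
Proof.
move=> gh; have [x /eqP/star_separated[J HJ]] : exists x, h x <> g x.
  apply: contrapT => nex; apply: gh; apply: shift_group_ext => x.
  by apply: contrapT => ghx; apply: nex; exists x => hg; apply: ghx.
exists (pickle (([::], g x, J) : star_code)).+1 => /(_ _ (ltnSn _)).
move/(congr1 (@^~ x)); rewrite /preimage /star_preim /= => E.
by move/negP: HJ; apply; rewrite -E; exact: star_self.
Qed.

Lemma sg_nbhs_filter g : ProperFilter (filter_from setT (agree ^~ g)).
Proof.
apply: filter_from_proper; last by move=> n _; exists g.
apply: filter_fromT_filter; first by exists 0%N.
move=> i j; exists (maxn i j) => h Hh.
by split; apply: agree_le Hh; rewrite ?leq_maxl ?leq_maxr.
Qed.

Lemma sg_nbhs_singleton g (A : set shift_group) :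
  filter_from setT (agree ^~ g) A -> A g.
Proof. by move=> [n _]; apply. Qed.

Lemma sg_nbhs_nbhs g (A : set shift_group) :
  filter_from setT (agree ^~ g) A ->
  filter_from setT (agree ^~ g) (fun h => filter_from setT (agree ^~ h) A).
Proof.
move=> [n _ Hn]; exists n => // h gh.
by exists n => // k hk; apply: Hn; exact: agree_trans hk.
Qed.

HB.instance Definition _ := hasNbhs.Build shift_group
  (fun g => filter_from setT (agree ^~ g)).
HB.instance Definition _ := Nbhs_isNbhsTopological.Build shift_group
  sg_nbhs_filter sg_nbhs_singleton sg_nbhs_nbhs.

Lemma sg_nbhsE (g : shift_group) (A : set shift_group) :
  nbhs g A <-> exists n, agree n g `<=` A.
Proof. by split=> [[n _ Hn]|[n Hn]]; exists n. Qed.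

Definition translate (s : seq shift_code) (i : star_code) : star_code :=
  (i.1.1 ++ s, i.1.2, i.2).

Lemma star_preim_translate (g : shift_group) i :
  g @^-1` star_preim i = star_preim (translate (code_of g) i).
Proof.
by apply/funext => x; rewrite /preimage /star_preim /= eval_cat -code_ofE.
Qed.

(** Only finitely many codes have number below [n], so one threshold serves them all. *)
Lemma pickle_bounded (F : star_code -> nat) n :
  exists N, forall i, (pickle i < n)%N -> (F i < N)%N.
Proof.
exists (\max_(k < n) if unpickle k is Some i then (F i).+1 else 0%N).
move=> i ni; have := leq_bigmax
  (F := fun k : 'I_n => if unpickle k is Some i then (F i).+1 else 0%N)
  (Ordinal ni).
by rewrite /= pickleK.
Qed.

(** For a base set [S], the preimage under [g * h] is unchanged if the left factor agrees with [g]
    on [S] and the right factor agrees with [h] on the preimage of [S] under [g], again a base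
    set. *)
Lemma sg_mul_continuous :
  continuous (fun p : shift_group * shift_group => (p.1 * p.2)%g).
Proof.
move=> [g h] U /sg_nbhsE[n HU].
have [N HN] := pickle_bounded (pickle \o translate (code_of g)) n.
exists (agree n g, agree N h); first by split; apply/sg_nbhsE; [exists n|exists N].
move=> [g' h'] [/= gg' hh']; apply: HU => i ni.
have mulE (a b : shift_group) (S : set word) :
    (a * b)%g @^-1` S = b @^-1` (a @^-1` S).
  by apply/funext => x; exact: (congr1 S (sg_mulE a b x)).
by rewrite !mulE -gg' // star_preim_translate; apply: hh'; exact: HN.
Qed.

Lemma sg_inv_continuous : continuous (fun g : shift_group => (g^-1)%g).
Proof.
move=> g U /sg_nbhsE[n HU].
have [N HN] := pickle_bounded (pickle \o translate (code_of g^-1%g)) n.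
apply/sg_nbhsE; exists N => g' gg'; apply: HU => i ni.
have invK (a : shift_group) (S : set word) : a @^-1` (a^-1%g @^-1` S) = S.
  by apply/funext => x; exact: (congr1 S (sg_invK a x)).
have invVK (a : shift_group) (S : set word) : a^-1%g @^-1` (a @^-1` S) = S.
  by apply/funext => x; exact: (congr1 S (sg_invVK a x)).
(* Agreement is used on the base set [T] that is the image of the [i]-th set [S] under [g]: then [S]
   is the preimage of [T] under [g'], so [T] is the preimage of [S] under the inverse of [g']. *)
have := gg' _ (HN i ni); rewrite -star_preim_translate invK => E.
by rewrite [in RHS]E invVK.
Qed.

Lemma sg_hausdorff : hausdorff_space shift_group.
Proof.
exact: (agreement_hausdorff agree_sym agree_trans agree_separated sg_nbhsE).
Qed.

HB.instance Definition _ := isTopologicalGroup.Build shift_group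
  sg_mul_continuous sg_inv_continuous sg_hausdorff.

Lemma sg_countable : countable [set: shift_group].
Proof.
apply/pcard_injP; exists (pickle \o code_of) => g h _ _ /=.
by move/(pcan_inj (@pickleK _))/(can_inj code_ofK).
Qed.

Lemma sg_metrizable (R : realType) : metrizable R shift_group.
Proof.
exact: (agreement_metrizable R agreexx agree_sym agree_trans agree_le
          agree_separated sg_nbhsE).
Qed.

(** * Action and compactifications *)

Lemma star_eval s J v :
  exists K, forall x, star K v x -> star J (eval s v) (eval s x).
Proof.
elim: s J => [|[[u l] d] s IH] J /=; first by exists J.
by have [K HK] := IH (J + `|d|)%N; exists K => x /HK; apply: star_shift.
Qed.

Lemma word_open_star_preim i : word_open (star_preim i).
Proof.
move=> v /(@word_open_star _ _)[J HJ].
by have [K HK] := star_eval i.1.1 J v; exists K => x /HK; apply: HJ.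
Qed.

Lemma star_preim_saturated i : eventually_saturated (star_preim i).
Proof.
case: i => [[s w] J]; rewrite /star_preim /=.
suff sat B : eventually_saturated B -> eventually_saturated (eval s @^-1` B).
  exact: (sat _ (@star_saturated J w)).
elim: s B => [|[[u l] d] s IH] B satB //=.
by apply: (IH (shift u l d @^-1` B)); apply: shift_saturated.
Qed.

(** If [h] agrees with [g] on the star of [g x], then [h] sends the whole preimage of this star
    under [g] into the star. *)
Lemma sg_act_continuous :
  continuous (fun p : shift_group * word => (p.1 : word -> word) p.2).
Proof.
move=> [g x] U /word_nbhsE[J HJ].
pose i : star_code := ([::], g x, J).
exists (agree (pickle i).+1 g, g @^-1` star_preim i).
  split; first by apply/sg_nbhsE; exists (pickle i).+1.
  rewrite star_preim_translate; apply: open_nbhs_nbhs; split.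
    exact/word_openP/word_open_star_preim.
  by rewrite -star_preim_translate; exact: star_self.
move=> [h y] [gh Hy]; apply: HJ.
by have : (h @^-1` star_preim i) y by rewrite -(gh i (ltnSn _)).
Qed.

Definition edge_shift (u : word) (j : int) (l : nat) (d : int) : shift_group :=
  of_code [:: (rcons u (l, j), 0%N, d)].

(** The bound is uniform in [d], because only the support of the shift matters; later [d] varies
    with [l]. *)
Lemma edge_shift_small n u j :
  exists L, forall l d, (L <= l)%N -> agree n 1%g (edge_shift u j l d).
Proof.
have /choice[F HF] : forall i, exists L, forall l, (L <= l)%N ->
    forall x y, x != [::] -> y != [::] ->
      star_preim i (u ++ (l, j) :: x) <-> star_preim i (u ++ (l, j) :: y).
  by move=> i; exact: star_preim_saturated.
have [L HL] := pickle_bounded F n.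
exists L => l d Ll i ni; apply/seteqP.
have main x : star_preim i x <-> star_preim i (edge_shift u j l d x).
  have [E|[y [z [y0 z0 -> E]]]] := shift_support (rcons u (l, j)) 0 d x.
    by rewrite /= E.
  rewrite /= E !cat_rcons; apply: HF => //.
  by apply: leq_trans Ll; apply: ltnW; exact: HL.
by split=> x; [exact: (main x).1|exact: (main x).2].
Qed.

(** * Equivariant maps to compact spaces are constant *)

Section TrivialCompactification.
Variables (K : topologicalType) (actK : shift_group -> K -> K) (i : word -> K).
Hypotheses (Kcompact : compact [set: K]) (Khaus : hausdorff_space K)
  (actKP : continuous_action actK) (icont : continuous i)
  (iequiv : forall g x, i ((g : shift_group) x) = actK g (i x)).

Let separate (p q : K) : p <> q ->
  exists A B, [/\ nbhs p A, nbhs q B & forall z, A z -> ~ B z].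
Proof.
move=> pq; apply: contrapT => nex; apply: pq; apply: Khaus => A B pA qB.
apply: contrapT => AB; apply: nex; exists A, B; split=> // z Az Bz.
by apply: AB; exists z.
Qed.

Variable F : set_system nat.
Hypotheses (Fultra : UltraFilter F) (Foo : \oo `<=` F).
Let Fproper : ProperFilter F := ultra_proper.

Let ultra_lim (a : nat -> K) : exists p : K, a @ F --> p.
Proof.
have [p [_ clp]] := Kcompact (fmap_proper_filter a Fproper) filterT.
exists p => U pU; have [//|FnU] := in_ultra_setVsetC (a @^-1` U) Fultra.
by have [y [nUy Uy]] := clp (~` U) U FnU pU.
Qed.

Let edge_shift_cvg u j (d : nat -> int) :
  (fun l => edge_shift u j l (d l)) @ F --> (1%g : shift_group).
Proof.
move=> U /sg_nbhsE[n HU]; have [L HL] := edge_shift_small n u j.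
by apply: Foo; exists L => // l /= Ll; apply: HU; exact: HL.
Qed.

(** Here [t l] is an endpoint of the edge [rcons u (l, j)]. Were [p] and [k] distinct, edge shifts
    could push the interior point [(0, 0)] so close to [t l] that its image lies near [p]; but they
    tend to 1, so these images tend to [k]. *)
Let edge_lim u j (t : nat -> word) (p k : K) :
  (forall l U, nbhs (t l) U -> exists d, U (rcons u (l, j) ++ [:: (0%N, d)])) ->
  (fun l => i (rcons u (l, j) ++ [:: (0%N, 0%R)])) @ F --> k ->
  (i \o t) @ F --> p -> p = k.
Proof.
move=> tP zk tp; apply: contrapT => /separate[A [B [pA kB AB]]].
(* The value 0 is a default for those [l] at which [i (t l)] is not interior to [A]; they do not
   form a set of [F]. *)
have /choice[d dP] : forall l, exists d, nbhs (i (t l)) A ->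
    A (i (rcons u (l, j) ++ [:: (0%N, d)])).
  move=> l; have [nA|nA] := pselect (nbhs (i (t l)) A); last by exists 0%R.
  by have [d Hd] := tP l _ (icont nA); exists d.
have gz : (fun l => actK (edge_shift u j l (d l))
    (i (rcons u (l, j) ++ [:: (0%N, 0%R)]))) @ F --> k.
  have := @cvg_comp _ _ _ _ (fun p : shift_group * K => actK p.1 p.2) F
    (nbhs (1%g, k)) _ (cvg_pair (edge_shift_cvg u j d) zk)
    (@cact_continuous _ _ _ actKP (1%g, k)).
  by rewrite /= (cact1 actKP) => cvg_gz; exact: cvg_gz.
have : F (fun l => A (i (rcons u (l, j) ++ [:: (0%N, d l)])) /\
                   B (i (rcons u (l, j) ++ [:: (0%N, d l)]))).
  have FA : F (fun l => nbhs (i (t l)) A) by exact: (tp _ (nbhs_interior pA)).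
  have FB : F (fun l => B (i (rcons u (l, j) ++ [:: (0%N, d l)]))).
    have : F (fun l => B (actK (edge_shift u j l (d l))
      (i (rcons u (l, j) ++ [:: (0%N, 0%R)])))) := gz B kB.
    apply: filterS => l; by rewrite /preimage /= -iequiv /= shift_cat /= add0r.
  by move: FA FB; apply: filterS2 => l /dP Al Bl; split.
by move/filter_ex => [l [/AB]].
Qed.

(** Both sequences of endpoints have the limit of the interior points between them. *)
Let lim_next u j (p : K) :
  (fun l => i (rcons u (l, j))) @ F --> p <->
  (fun l => i (rcons u (l, (j + 1)%R))) @ F --> p.
Proof.
have [k zk] := ultra_lim (fun l => i (rcons u (l, j) ++ [:: (0%N, 0%R)])).
have left l (U : set word) : nbhs (rcons u (l, j) : word) U ->
    exists d, U (rcons u (l, j) ++ [:: (0%N, d)]).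
  move=> /word_nbhsE[J HJ]; exists (- J.+1%:Z)%R; apply: HJ.
  by apply: around_cat => /=; lia.
have right l (U : set word) : nbhs (rcons u (l, (j + 1)%R) : word) U ->
    exists d, U (rcons u (l, j) ++ [:: (0%N, d)]).
  move=> /word_nbhsE[J HJ]; exists (Posz J.+1); apply: HJ.
  have -> : (l, j) = prev (l, (j + 1)%R) by rewrite /prev /= addrK.
  by apply: around_prev => /=; lia.
have [p1 Hp1] := ultra_lim (fun l => i (rcons u (l, j))).
have [p2 Hp2] := ultra_lim (fun l => i (rcons u (l, (j + 1)%R))).
have E1 := edge_lim left zk Hp1; have E2 := edge_lim right zk Hp2.
split=> H; first by rewrite (edge_lim left zk H) -E2.
by rewrite (edge_lim right zk H) -E1.
Qed.

Let lim_all u : exists p : K, forall j, (fun l => i (rcons u (l, j))) @ F --> p.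
Proof.
have [p Hp] := ultra_lim (fun l => i (rcons u (l, 0%R))); exists p.
have pos n : (fun l => i (rcons u (l, Posz n))) @ F --> p.
  elim: n => [|n /lim_next] //.
  by have -> : (n%:Z + 1 = n.+1%:Z)%R by lia.
have neg n : (fun l => i (rcons u (l, - n%:Z)%R)) @ F --> p.
  elim: n => [|n IH] //; apply/lim_next.
  by have -> : (- n.+1%:Z + 1 = - n%:Z)%R by lia.
move=> j; have [n [->|->]] // : exists n : nat, j = n \/ j = (- n%:Z)%R.
by exists `|j|%N; lia.
Qed.

(** Every star of either endpoint of the edge contains, for some index [j], the vertices [(l, j)] of
    all arcs simultaneously. Their limit over [l] is the same [p] for every [j], so both endpoints
    are sent to [p]. *)
Let rcons_prev u c : i (rcons u (prev c)) = i (rcons u c).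
Proof.
have [p Hp] := lim_all (rcons u (prev c)).
have lim_eq v :
    (forall J, exists j, forall l,
      star J v (rcons (rcons u (prev c)) (l, j))) -> i v = p.
  move=> vP; apply: contrapT => /separate[A [B [vA pB AB]]].
  have [J HJ] := (word_nbhsE _ _).1 (icont vA); have [k Hk] := vP J.
  have FB : F (fun l => B (i (rcons (rcons u (prev c)) (l, k)))) := Hp k B pB.
  by have [l Bl] := filter_ex FB; exact: (AB _ (HJ _ (Hk l)) Bl).
rewrite (lim_eq (rcons u (prev c))) ?(lim_eq (rcons u c)) // => J.
  exists (Posz J.+1) => l; rewrite -[rcons (rcons _ _) _]cats1.
  by apply: around_prev => /=; lia.
exists (- J.+1%:Z)%R => l; rewrite -[rcons (rcons _ _) _]cats1.
by apply: around_cat => /=; lia.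
Qed.

(** All vertices of one arc have the same image, and they tend to [u] as the index tends to minus
    infinity. *)
Let rcons_const u c : i (rcons u c) = i u.
Proof.
case: c => l j.
have step k : i (rcons u (l, (k + 1)%R)) = i (rcons u (l, k)).
  have -> : (l, k) = prev (l, (k + 1)%R) by rewrite /prev /= addrK.
  by rewrite rcons_prev.
have const k : i (rcons u (l, k)) = i (rcons u (l, 0%R)).
  have [n [->|->]] : exists n : nat, k = n \/ k = (- n%:Z)%R.
  - by exists `|k|%N; lia.
  - elim: n => [|n IH] //.
    by rewrite -IH -[RHS]step; congr (i (rcons u (l, _))); lia.
  - elim: n => [|n IH] //.
    by rewrite -IH -[LHS]step; congr (i (rcons u (l, _))); lia.
apply: contrapT => /separate[A [B [cA uB AB]]].
have [J HJ] := (word_nbhsE _ _).1 (icont uB).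
have : B (i (rcons u (l, (- J.+1%:Z)%R))).
  by apply: HJ; rewrite -cats1; apply: around_cat => /=; lia.
by rewrite const -(const j); apply: AB; exact: nbhs_singleton.
Qed.

Lemma equivariant_map_constant x : i x = i [::].
Proof. by elim/last_ind: x => // x c <-; exact: rcons_const. Qed.

End TrivialCompactification.

Theorem mainTheorem1 (R : realType) :
  exists (G : topologicalGroupType) (act : G -> rat^o -> rat^o),
    [/\ countable [set: G],
        metrizable R G,
        continuous_action act
      & forall (K : topologicalType) (actK : G -> K -> K) (i : rat^o -> K),
          equivariant_compactification act actK i ->
          exists k : K, [set: K] = [set k]].
Proof.
have [f [g [fK gK] [fcont gcont]]] :=
  tree_space_homeomorphic word_tree_space rat_tree_space.
(* The action on words is carried to the rationals along the homeomorphism of the two tree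
   spaces. *)
exists shift_group, (fun a q => f ((a : shift_group) (g q))).
split; [exact: sg_countable|exact: sg_metrizable| |].
  split.
  - by move=> q; rewrite /= gK.
  - by move=> a b q; rewrite fK; congr f; exact: sg_mulE.
  - move=> [a q]; have act_cvg : (fun p : shift_group * rat^o =>
        (p.1 : word -> word) (g p.2)) p @[p --> (a, q)] --> a (g q).
      have gq : (fun p : shift_group * rat^o => g p.2) @ (a, q) --> g q.
        exact: (@cvg_comp _ _ _ snd g (nbhs (a, q)) (nbhs q) _ cvg_snd (gcont q)).
      have pq : (fun p : shift_group * rat^o => p.1) @ (a, q) --> a.
        exact: cvg_fst.
      exact: (@cvg_comp _ _ _ _ (fun p : shift_group * word => (p.1 : word -> word) p.2)
        (nbhs (a, q)) (nbhs (a, g q)) _ (cvg_pair pq gq) (@sg_act_continuous (a, g q))).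
    exact: cvg_comp act_cvg (fcont _).
move=> K actK i [Kcompact Khaus actKP icont iequiv idense].
have [F [Fultra Foo]] := ultraFilterLemma (@eventually_filter).
have ic x : i x = i (f [::]).
  rewrite -[x]gK.
  apply: (@equivariant_map_constant K actK (i \o f) Kcompact Khaus actKP _ _ F).
  - by move=> w; apply: cvg_comp (fcont w) (icont _).
  - by move=> a w; rewrite /= -iequiv fK.
  - exact: Foo.
exists (i (f [::])); apply/seteqP; split=> // k _ /=.
apply: contrapT => kp.
(* A second point of [K] would make the complement of the constant value a nonempty open set, which
   a dense range must meet. *)
have : ~` [set i (f [::])] `&` range i !=set0.
  apply: idense; first by exists k.
  exact/closed_openC/accessible_closed_set1/hausdorff_accessible.
by move=> [k' [np [x _ xk']]]; apply: np; rewrite -xk'; exact: ic.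
Qed.
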